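(* Let $q$ be a prime power and let $n=p^r$, where $p$ is prime and $r\ge 1$. Let $m$ be an integer with $1\le m<n$, and choose the integer $j$ such that $$p^j\le m<p^{j+1},\qquad 0\le j\le r-1.$$ Then the number of $m$-dimensional Chowla $\mathbb{F}_q$-subspaces of $\mathbb{F}_{q^n}/\mathbb{F}_q$ is $$q^{p^jm}\genfrac{[}{]}{0pt}{}{p^r-p^j}{m}_{q}.$$
   Context: For a finite field extension $K\subseteq L$ with $[L:K]>1$, a nonzero $K$-subspace $A\subseteq L$ is called a Chowla subspace if $[K(a):K]>\dim_K A$ for every $0\ne a\in A$. Here $K=\mathbb{F}_q$ and $L=\mathbb{F}_{q^n}$. The Gaussian binomial coefficient $\genfrac{[}{]}{0pt}{}{a}{b}_{q}$ is the number of $b$-dimensional subspaces of an $a$-dimensional vector space over $\mathbb{F}_q$; it is zero when $b<0$ or $b>a$. *)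

(* Defs.v *)
From HB Require Import structures.
From mathcomp Require Import all_boot all_order all_algebra all_field.

Set Implicit Arguments.
Unset Strict Implicit.
Unset Printing Implicit Defensive.

Import GRing.Theory.
Local Open Scope ring_scope.

Section VspaceFinite.
Import VectorInternalTheory.
Variables (F : finFieldType) (vT : vectType F).

HB.instance Definition _ := [Countable of {vspace vT} by <:].
HB.instance Definition _ := [Finite of {vspace vT} by <:].

End VspaceFinite.

Definition is_chowla (K : fieldType) (L : fieldExtType K) (A : {vspace L}) :
    Prop :=
  A <> 0%VS /\
  forall a : L, a \in A -> a <> 0 -> (\dim A < \dim <<1%VS; a>>%VS)%N.

(* Boolean version for counting: L itself carries no finType structure, so a
   ranges over its alias finvect_type L. *)
Definition chowla (K : finFieldType) (L : fieldExtType K) (A : {vspace L}) :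
    bool :=
  (A != 0%VS) &&
  [forall a : finvect_type L,
     ((a : L) \in A) ==> ((a : L) != 0) ==>
     (\dim A < \dim <<1%VS; (a : L)>>%VS)%N].

Lemma chowlaP (K : finFieldType) (L : fieldExtType K) (A : {vspace L}) :
  reflect (is_chowla A) (chowla A).
Proof.
apply: (iffP andP) => -[A0 hA].
- split=> [|a aA a0]; first exact/eqP.
  by move/forallP: hA => /(_ a) /implyP/(_ aA) /implyP/(_ (introN eqP a0)).
- split; first exact/eqP.
  apply/forallP => a; apply/implyP => aA; apply/implyP => /eqP a0.
  exact: hA.
Qed.

Definition gauss_binom (K : finFieldType) (a b : nat) : nat :=
  #|[set U : {vspace 'rV[K]_a} | \dim U == b]|.

(* Main.v *)
Require Import Defs.
From HB Require Import structures.
From mathcomp Require Import all_boot all_order all_algebra all_field.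
From mathcomp Require Import all_fingroup all_solvable.

Set Implicit Arguments.
Unset Strict Implicit.
Unset Printing Implicit Defensive.

Import GRing.Theory.
Local Open Scope ring_scope.

(** Why the count holds.

    Every element of L generates a subfield whose degree over K divides p ^ r,
    hence is a power of p. When p ^ j <= m < p ^ j.+1, such a degree is at most
    m exactly when it divides p ^ j. A finite field extension has a single
    subfield of each admissible degree, and these are nested as their degrees
    divide one another; so the elements of degree at most m are precisely those
    of the subfield M of degree p ^ j, and an m-dimensional A is a Chowla
    subspace if and only if it meets M trivially. The two facts on subfields,
    [exists_subfield] and [subfield_sub_dim_dvd], come from the Galois
    correspondence, because the Galois group of L over K is cyclic.

    What remains is linear algebra ([card_disjoint_subspaces]): count the
    m-dimensional subspaces A of an n-dimensional space that meet a given
    k-dimensional M trivially. An m-tuple is a basis of such an A if and only if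
    it is linearly independent modulo M. Choosing its entries one at a time
    gives \prod_(i < m) (q ^ n - q ^ (k + i)) tuples, and each A has
    \prod_(i < m) (q ^ m - q ^ i) ordered bases. Since
    q ^ n - q ^ (k + i) = q ^ k * (q ^ (n - k) - q ^ i), comparing with the case
    k = 0 in dimension n - k, which counts the Gaussian binomial coefficient,
    yields q ^ (k * m) * gauss_binom K (n - k) m. *)

(** * Subspaces meeting a fixed subspace trivially *)

Section CountDisjoint.

Variables (K : finFieldType) (vT : vectType K).
Local Notation V := (finvect_type vT).
Local Notation q := #|K|.
Implicit Types (U M A : {vspace V}) (x : V).

(** The dimension condition expresses that the entries of t are linearly
    independent in the quotient by M, without forming that quotient. *)
Definition free_mod_in U M m : {set m.-tuple V} :=
  [set t : m.-tuple V |
     all (fun x => x \in U) t & \dim (M + <<t>>) == (\dim M + m)%N].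

(** An independent tuple modulo M extends by exactly the vectors of U outside
    M + <<t>>; this drives the recursive count of such tuples. *)
Lemma free_mod_in_cons U M m x (t : m.-tuple V) :
  ([tuple of x :: t] \in free_mod_in U M m.+1) =
  (t \in free_mod_in U M m) && (x \in U) && (x \notin (M + <<t>>)%VS).
Proof.
rewrite !inE /= span_cons addvA [(M + _)%VS]addvC -addvA.
set W := (M + _)%VS.
have leW : (\dim W <= \dim M + m)%N.
  apply: leq_trans (dimv_add_leqif _ _) _.
  by rewrite leq_add2l (leq_trans (dim_span _)) // size_tuple.
case: (boolP (x \in W)) => xW.
  (* The dimension has not grown, so it misses the value required of m.+1. *)
  rewrite (addv_idPr _) // andbF; apply/negbTE/nandP; right.
  by rewrite addnS neq_ltn ltnS leW.
have -> : \dim (<[x]> + W) = (\dim W).+1.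
  have x0 : x != 0 by apply: contraNneq xW => ->; apply: mem0v.
  rewrite dimv_disjoint_sum ?dim_vline ?x0 //.
  apply/eqP; rewrite -subv0; apply/subvP => y; rewrite memv_cap memv0.
  case/andP => /vlineP[k ->] kxW; apply/eqP.
  have [->|k0] := eqVneq k 0; first by rewrite scale0r.
  by rewrite -(scalerK k0 x) memvZ // in xW.
by rewrite addnS eqSS andbT; case: (x \in U) => /=; rewrite ?andbT ?andbF.
Qed.

(** Once i entries are chosen, the next one avoids the q ^ (\dim M + i) vectors
    of the span of M and these entries. When \dim M + m exceeds \dim U the factor
    at i = \dim U - \dim M vanishes, so truncated subtraction is harmless. *)
Lemma card_free_mod_in U M m :
  (M <= U)%VS ->
  #|free_mod_in U M m| = (\prod_(i < m) (q ^ \dim U - q ^ (\dim M + i)))%N.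
Proof.
move=> MU; elim: m => [|m IHm].
  rewrite big_ord0; apply/eqP/cards1P; exists [tuple].
  apply/setP => t; rewrite !inE tuple0 /= span_nil addv0 addn0 eqxx.
  by rewrite eqxx.
rewrite big_ord_recr /= -IHm -sum_nat_const -sum1_card.
rewrite (partition_big (fun t : m.+1.-tuple V => [tuple of behead t] : m.-tuple V)
          (fun t : m.-tuple V => t \in free_mod_in U M m)) /=; last first.
  move=> t; case/tupleP: t => x t; rewrite free_mod_in_cons.
  by rewrite (_ : [tuple of _] = t) => [/andP[/andP[->]]//|]; apply/val_inj.
(* The tuples with tail t biject with the vectors of U outside W. *)
apply: eq_bigr => t tP; rewrite sum1_card.
pose W := (M + <<t>>)%VS.
have dW : \dim W = (\dim M + m)%N by move: tP; rewrite inE => /andP[_ /eqP].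
have sWU : (W <= U)%VS.
  rewrite subv_add MU; apply/span_subvP => y yt.
  by move: tP; rewrite inE => /andP[/allP/(_ _ yt)].
pose D := [set x : V | (x \in U) && (x \notin W)].
have cons_inj : injective (fun x : V => [tuple of x :: t]).
  by move=> x y /(congr1 val) [].
transitivity #|[set [tuple of x :: t] | x in D]|.
  apply: eq_card => u; rewrite [LHS]unfold_in; case/tupleP: u => x u.
  rewrite free_mod_in_cons.
  apply/andP/imsetP => [[/andP[/andP[uP xU] xW] /eqP eu]|[y yD /(congr1 val)[-> eu]]].
    have {}eu : u = t by rewrite -eu; apply: val_inj.
    by rewrite eu in xW *; exists x; rewrite // inE xU.
  have {}eu : u = t by apply: val_inj.
  rewrite eu; split; last by apply/eqP/val_inj.
  by move: yD; rewrite inE -andbA tP.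
rewrite card_imset // -dW -!card_vspace.
have -> : #|D| = #|[predD U & W]|.
  by apply: eq_card => x; rewrite !inE andbC.
apply/eqP; rewrite -(eqn_add2l #|[predI U & W]|) cardID.
have -> : #|[predI U & W]| = #|W|.
  by apply: eq_card => x; rewrite !inE andb_idl // => /(subvP sWU).
by rewrite subnKC //; apply: subset_leq_card; apply/subsetP/subvP.
Qed.

(** The ordered bases of A are the tuples of A that are independent modulo 0. *)
Lemma card_spanning_tuples A m :
  \dim A = m ->
  #|[set t : m.-tuple V | <<t>>%VS == A]| =
    (\prod_(i < m) (q ^ m - q ^ i))%N.
Proof.
move=> dA; have := card_free_mod_in m (sub0v A).
rewrite dimv0 dA => <-; apply: eq_card => t; rewrite !inE add0v dimv0 add0n.
apply/eqP/andP => [tA|[/allP tA dt]].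
  rewrite tA dA eqxx; split=> //; apply/allP => y yt.
  by rewrite -tA; apply: memv_span.
by apply/eqP; rewrite eqEdim dA (eqP dt) leqnn andbT; apply/span_subvP.
Qed.

Definition disjoint_subspaces M m : {set {vspace V}} :=
  [set A : {vspace V} | (\dim A == m) && ((M :&: A)%VS == 0%VS)].

(** Double counting of the m-tuples independent modulo M, grouped by their
    span: these spans are exactly the m-dimensional subspaces disjoint from M,
    and the group over A consists of all the ordered bases of A. *)
Lemma card_disjoint_subspaces_mul M m :
  (#|disjoint_subspaces M m| * \prod_(i < m) (q ^ m - q ^ i))%N =
  (\prod_(i < m) (q ^ \dim {:V} - q ^ (\dim M + i)))%N.
Proof.
rewrite -(card_free_mod_in _ (subvf M)) -sum_nat_const -[RHS]sum1_card.
rewrite (partition_big (fun t : m.-tuple V => <<t>>%VS)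
          (fun A => A \in disjoint_subspaces M m)) /=; last first.
  move=> t; rewrite !inE => /andP[_ /eqP dMt].
  have := dimv_sum_cap M <<t>>%VS; rewrite dMt -addnA => /addnI dt.
  have := dim_span t; rewrite size_tuple -dt -dimv_eq0 => le.
  have c0 : \dim (M :&: <<t>>) = 0%N.
    by apply/eqP; rewrite -leqn0 -(leq_add2l m) addn0.
  by rewrite c0 addn0 !eqxx.
apply: eq_bigr => A; rewrite inE => /andP[/eqP dA /eqP MA].
rewrite -(card_spanning_tuples dA) sum1_card; apply: eq_card => t.
rewrite [RHS]unfold_in !inE andb_idl // => /eqP ->.
rewrite dimv_disjoint_sum // dA eqxx andbT.
by apply/allP => x _; apply: memvf.
Qed.

End CountDisjoint.

(** The case M = 0, where disjointness is vacuous. *)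
Lemma gauss_binom_mul (K : finFieldType) (a m : nat) :
  (gauss_binom K a m * \prod_(i < m) (#|K| ^ m - #|K| ^ i))%N =
  (\prod_(i < m) (#|K| ^ a - #|K| ^ i))%N.
Proof.
have := card_disjoint_subspaces_mul (0%VS : {vspace finvect_type 'rV[K]_a}) m.
rewrite dimv0 dimvf /dim /= mul1n => <-; congr (_ * _)%N.
by apply: eq_card => A; rewrite !inE cap0v eqxx andbT.
Qed.

(** Each factor q ^ n - q ^ (\dim M + i) contributes q ^ \dim M, leaving the
    product that belongs to the Gaussian binomial in dimension n - \dim M. *)
Lemma card_disjoint_subspaces (K : finFieldType) (vT : vectType K)
    (M : {vspace finvect_type vT}) (m : nat) :
  #|disjoint_subspaces M m| =
  (#|K| ^ (\dim M * m) *
     gauss_binom K (\dim {: finvect_type vT} - \dim M) m)%N.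
Proof.
have q_gt1 : (1 < #|K|)%N := finNzRing_gt1 K.
have P_gt0 : (0 < \prod_(i < m) (#|K| ^ m - #|K| ^ i))%N.
  by apply: prodn_gt0 => i; rewrite subn_gt0 ltn_exp2l.
apply/eqP; rewrite -(eqn_pmul2r P_gt0) -mulnA gauss_binom_mul; apply/eqP.
rewrite card_disjoint_subspaces_mul expnM.
have -> : ((#|K| ^ \dim M) ^ m = \prod_(i < m) #|K| ^ \dim M)%N.
  by rewrite prod_nat_const card_ord.
rewrite -big_split; apply: eq_bigr => i _ /=.
by rewrite mulnBr -!expnD subnKC // dimvS // subvf.
Qed.

(** * Subfields of a finite field *)

Section Subfields.

Local Open Scope group_scope.
Local Open Scope ring_scope.

Variables (K : finFieldType) (L : splittingFieldType K).
Implicit Types E F : {subfield L}.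

Lemma cyclic_gal : cyclic 'Gal({:L} / 1%AS).
Proof.
have [s /eqP-> _] := finField_galois_generator (sub1v {:L}%AS).
exact: cycle_cyclic.
Qed.

Lemma card_gal_sub E : (#|'Gal({:L} / E)| * \dim E)%N = \dim {:L}.
Proof.
by rewrite -galois_dim ?finField_galois ?subvf // divnK ?field_dimS ?subvf.
Qed.

(** In a cyclic group, divisibility of orders forces inclusion of subgroups;
    the Galois correspondence, which reverses inclusions, carries this over to
    subfields. In particular a subfield is determined by its degree. *)
Lemma subfield_sub_dim_dvd E F : (\dim E %| \dim F)%N -> (E <= F)%VS.
Proof.
case/dvdnP => c dF.
have gal1 (G : {subfield L}) : 'Gal({:L} / G) \subset 'Gal({:L} / 1%AS).
  by apply: galS; apply: sub1v.
have fixG (G : {subfield L}) : fixedField 'Gal({:L} / G) = G :> {vspace L}.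
  by apply/galois_fixedField/finField_galois/subvf.
rewrite -(fixG E) -(fixG F); apply: fixedFieldS.
rewrite -(cardSg_cyclic cyclic_gal (gal1 F) (gal1 E)).
have := card_gal_sub E; rewrite -(card_gal_sub F) dF mulnA.
by move/eqP; rewrite eqn_pmul2r ?adim_gt0 // => /eqP->; apply: dvdn_mulr.
Qed.

(** If s generates the Galois group, then s ^+ d has order \dim {:L} %/ d, so its
    fixed field has degree d. *)
Lemma exists_subfield d : (d %| \dim {:L})%N -> exists E, \dim E = d.
Proof.
move=> dvd; have [s /eqP defG _] := finField_galois_generator (sub1v {:L}%AS).
have os : #[s]%g = \dim {:L}.
  by rewrite orderE -defG -[RHS](card_gal_sub 1%AS) dimv1 muln1.
pose H := <[(s ^+ d)%g]>%G; exists (fixedField_aspace H).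
have oH : #|H| = (\dim {:L} %/ d)%N by rewrite -os -orderXdiv ?os.
have H0 := cardG_gt0 H.
apply/eqP; rewrite -(eqn_pmul2l H0); apply/eqP.
rewrite {1}dim_fixedField divnK ?field_dimS ?subvf //=.
by rewrite oH divnK.
Qed.

End Subfields.

Theorem theorem5p5 (q p r n m j : nat) (K : finFieldType) (L : fieldExtType K)
    (hq : #|K| = q) (hL : \dim {:L} = n)
    (hp : prime p) (hr : (1 <= r)%N) (hn : n = (p ^ r)%N)
    (hm : (1 <= m < n)%N)
    (hj : (p ^ j <= m < p ^ j.+1)%N) (hjr : (0 <= j <= r - 1)%N) :
  #|[set A : {vspace L} | chowla A & \dim A == m]|
    = (q ^ (p ^ j * m) * gauss_binom K (p ^ r - p ^ j) m)%N.
Proof.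
pose L' : splittingFieldType K := FinSplittingFieldType K L.
have [M dM] : exists M : {subfield L'}, \dim M = (p ^ j)%N.
  apply: exists_subfield; rewrite [\dim _]hL hn dvdn_exp2l //.
  by apply: leq_trans hjr _; apply: leq_subr.
have [m_gt0 _] := andP hm; have [ge_m lt_m] := andP hj.
have p_gt1 := prime_gt1 hp.
(* M is the set of all elements of degree at most m: a degree p ^ i <= m has
   i <= j, hence divides the degree p ^ j of M. *)
have mem_M (a : L') : (\dim <<1%VS; a>>%VS <= m)%N = (a \in M).
  apply/idP/idP => [le_am|aM].
    have /(dvdn_pfactor _ _ hp)[i _ di] : (\dim <<1%VS; a>>%VS %| p ^ r)%N.
      by rewrite -hn -hL; apply: (@field_dimS _ L' _ {:L'}%AS); apply: subvf.
    have le_ij : (i <= j)%N.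
      by rewrite -ltnS -(ltn_exp2l _ _ p_gt1) -di (leq_ltn_trans le_am).
    suffices /subvP : (<<1%VS; a>>%VS <= M)%VS by apply; apply: memv_adjoin.
    by apply: subfield_sub_dim_dvd; rewrite di dM dvdn_exp2l.
  apply: leq_trans ge_m; rewrite -dM; apply: dimvS.
  by apply/FadjoinP; rewrite sub1v.
have -> : #|[set A : {vspace L} | chowla A & \dim A == m]| =
          #|disjoint_subspaces (M : {vspace finvect_type L}) m|.
  apply: eq_card => A; rewrite !inE andbC; apply: andb_id2l => /eqP dA.
  apply/chowlaP/eqP => [[A0 chA]|MA].
    apply/eqP; rewrite -subv0; apply/subvP => a; rewrite memv_cap memv0.
    case/andP => aM aA; apply/eqP; apply: contraTeq isT => /eqP a0.
    by have := chA a aA a0; rewrite dA ltnNge mem_M aM.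
  split=> [A0|a aA a0]; first by move: m_gt0; rewrite -dA A0 dimv0.
  rewrite dA ltnNge mem_M; apply/negP => aM; apply: a0; apply/eqP.
  by rewrite -memv0 -MA memv_cap aM.
by rewrite card_disjoint_subspaces hq [\dim M]dM [\dim {: _}]hL hn.
Qed.
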